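(* Let $(X,+)$, $(Y,+)$ be abelian Polish groups, $\mathcal{A}\subseteq P(X)$, $\mathcal{B}\subseteq P(Y)$ $\sigma$-algebras, and $\mathcal{I}\subseteq P(X)$, $\mathcal{J}\subseteq P(Y)$ $\sigma$-ideals containing all singletons, such that every member of $\mathcal{I}$ is contained in a member of $\mathcal{A}\cap\mathcal{I}$ and every member of $\mathcal{J}$ is contained in a member of $\mathcal{B}\cap\mathcal{J}$. Let $\mathcal{C}=\mathcal{A}\otimes\mathcal{B}$ and assume that (i) $(\mathcal{C},\mathcal{I}\otimes\mathcal{J})$ has the Tall Rectangle Hull Property (TRHP) and $(\mathcal{A},\mathcal{I})$ has the Smital Property (SP), or (ii) $(\mathcal{C},\mathcal{I}\otimes\mathcal{J})$ has the Wide Rectangle Hull Property (WRHP) and $(\mathcal{B},\mathcal{J})$ has SP. Then $(\mathcal{C},\mathcal{I}\otimes\mathcal{J})$ has SP.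
   Context: $\mathcal{A}\otimes\mathcal{B}$ is the $\sigma$-algebra on $X\times Y$ generated by the rectangles $A\times B$ with $A\in\mathcal{A}$, $B\in\mathcal{B}$. For $C\subseteq X\times Y$ and $x\in X$, $C_x=\{y\in Y:(x,y)\in C\}$. Fubini product: $K\in\mathcal{I}\otimes\mathcal{J}$ iff there is $C\in\mathcal{A}\otimes\mathcal{B}$ with $K\subseteq C$ and $\{x\in X:C_x\notin\mathcal{J}\}\in\mathcal{I}$. SP for a pair ($\sigma$-algebra $\mathcal{S}$, $\sigma$-ideal $\mathcal{K}$) on an abelian Polish group $Z$: for every dense $D\subseteq Z$ and every $A\in\mathcal{S}\setminus\mathcal{K}$ the set $A+D=\{a+d:a\in A,d\in D\}$ is $\mathcal{K}$-residual, i.e. its complement belongs to $\mathcal{K}$. TRHP for $(\mathcal{A}\otimes\mathcal{B},\mathcal{I}\otimes\mathcal{J})$: for every $C\in\mathcal{A}\otimes\mathcal{B}$ there are $\widetilde{C}\in\mathcal{A}$, $I\in\mathcal{I}$, $J\in\mathcal{J}$ with $$(\widetilde{C}\setminus I)\times(Y\setminus J)\subseteq C\subseteq(\widetilde{C}\times Y)\cup(I\times Y)\cup(X\times J).$$ WRHP: for every $C\in\mathcal{A}\otimes\mathcal{B}$ there are $\widetilde{C}\in\mathcal{B}$, $I\in\mathcal{I}$, $J\in\mathcal{J}$ with $$(X\setminus I)\times(\widetilde{C}\setminus J)\subseteq C\subseteq(X\times\widetilde{C})\cup(I\times Y)\cup(X\times J).$$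
   Formalization: The formal theorem additionally assumes that J is translation invariant in alternative (i) and that I is translation invariant in alternative (ii); without such an assumption the statement is false. *)

(* Defs.v *)
From HB Require Import structures.
From mathcomp Require Import all_boot all_order all_algebra.
From mathcomp Require Import all_classical all_reals all_analysis.

Set Implicit Arguments.
Unset Strict Implicit.
Unset Printing Implicit Defensive.

Import Order.TTheory GRing.Theory Num.Theory.
Local Open Scope classical_set_scope.
Local Open Scope ring_scope.

(* Makes [X * Y] a type with both a topology and an addition. The library has a
   topological-group instance on products only for modules over a field. *)
HB.saturate prod.

(* A Polish space is separable and homeomorphic to a complete metric space. The
   metric is not part of the structure and need not be translation invariant. *)
Definition polish_space (R : realType) (T : topologicalType) :=
  (exists2 D : set T, countable D & dense D) /\
  exists (M : metricType R) (f : T -> M) (g : M -> T),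
    [/\ cancel f g, cancel g f, continuous f, continuous g &
        forall F : set_system M, ProperFilter F -> cauchy F ->
          exists l : M, F --> l].

(* Properness is not required: [setT] may belong to a sigma-ideal. *)
Definition sigma_ideal (T : Type) (K : set (set T)) :=
  [/\ K set0,
      forall A B : set T, A `<=` B -> K B -> K A &
      forall F : (set T)^nat, (forall n, K (F n)) -> K (\bigcup_n F n)].

Definition contains_singletons (T : Type) (K : set (set T)) :=
  forall x : T, K [set x].

Definition has_base (T : Type) (S K : set (set T)) :=
  forall A : set T, K A -> exists2 B : set T, (S `&` K) B & A `<=` B.

Definition translation_invariant (Z : zmodType) (K : set (set Z)) :=
  forall (z : Z) (A : set Z), K A -> K [set z + a | a in A].

Definition prod_sigma_algebra (X Y : Type)
    (A : set (set X)) (B : set (set Y)) : set (set (X * Y)) :=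
  <<s [set P `*` Q | P in A & Q in B] >>.

Definition fubini_product (X Y : Type) (A : set (set X)) (B : set (set Y))
    (I : set (set X)) (J : set (set Y)) : set (set (X * Y)) :=
  [set K | exists2 C : set (X * Y), prod_sigma_algebra A B C &
     K `<=` C /\ I [set x | ~ J (xsection C x)]].

(* The definition involves only the topology and the addition of [Z], so no
   continuity of the operations is asked for here. *)
Definition smital_property (Z : PreTopologicalZmodule.type) (S K : set (set Z)) :=
  forall D : set Z, dense D ->
  forall A : set Z, (S `\` K) A -> K (~` [set a + d | a in A & d in D]).

Definition tall_rectangle_hull (X Y : Type) (A : set (set X)) (B : set (set Y))
    (I : set (set X)) (J : set (set Y)) :=
  forall C : set (X * Y), prod_sigma_algebra A B C ->
  exists (Ct : set X) (I0 : set X) (J0 : set Y),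
    [/\ A Ct, I I0, J J0,
        (Ct `\` I0) `*` (setT `\` J0) `<=` C &
        C `<=` (Ct `*` setT) `|` (I0 `*` setT) `|` (setT `*` J0)].

Definition wide_rectangle_hull (X Y : Type) (A : set (set X)) (B : set (set Y))
    (I : set (set X)) (J : set (set Y)) :=
  forall C : set (X * Y), prod_sigma_algebra A B C ->
  exists (Ct : set Y) (I0 : set X) (J0 : set Y),
    [/\ B Ct, I I0, J J0,
        (setT `\` I0) `*` (Ct `\` J0) `<=` C &
        C `<=` (setT `*` Ct) `|` (I0 `*` setT) `|` (setT `*` J0)].

(* Main.v *)
Require Import Defs.
From mathcomp Require Import all_boot all_order all_algebra.
From mathcomp Require Import all_classical all_reals all_analysis.

(** Suppose the tall hull property holds (the wide case is the same argument
    with the two factors exchanged).  Let [C] be measurable and not null, with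
    hull [Ct] and exceptional sets [I0], [J0].  The upper inclusion traps [C] in
    the cross [(Ct `|` I0) x Y `|` X x J0], and a cross over two null sets is
    null ([fubini_product_cross]); hence [Ct] is not in [I], and removing a
    measurable null set containing [I0] leaves a measurable [E], still not in
    [I], with [E x (Y \ J0)] contained in [C] ([measurable_core]).

    Given a dense [D], choose a countable [D'] contained in [D] whose projection
    to [X] is still dense ([countable_dense_image]), which is possible because
    [X] is separable and metrizable.  By the Smital property the set [N] of points outside
    [E + fst D'] is in [I].  For a point [(x, y)] with [x] outside [N], write
    [x = a + d.1] with [a] in [E] and [d] in [D'].  Then [(x, y) - d] lies over
    [a], so it belongs to [C] as soon as [y - d.2] is not in [J0].  Therefore the
    complement of [C + D] is contained in the cross over [N] and the union of
    the translates [d.2 + J0] for [d] in [D'] ([compl_sumset_sub_cross]).  This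
    union is in [J] because [D'] is countable and [J] is translation invariant;
    a union over all of [D] could leave [J].  So the complement of [C + D] is
    null. *)

Set Implicit Arguments.
Unset Strict Implicit.
Unset Printing Implicit Defensive.

Local Open Scope classical_set_scope.
Import Order.TTheory GRing.Theory Num.Theory.

(** An injection [e] of [D] into [nat] sorts the sets [F d] into the fibres of
    [e], each of which contains at most one of them; this spares choosing an
    enumeration of [D], which could be empty. *)
Lemma sigma_ideal_bigcup (T V : Type) (K : set (set T)) (D : set V)
    (F : V -> set T) :
  sigma_ideal K -> countable D -> (forall d, D d -> K (F d)) ->
  K (\bigcup_(d in D) F d).
Proof.
move=> [K0 Ksub Kbig] /countable_injP[e inj_e] KF.
apply: (Ksub _ (\bigcup_n \bigcup_(d in [set d | D d /\ e d = n]) F d)).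
  by move=> z [d Dd Fdz]; exists (e d) => //; exists d.
apply: Kbig => n; have [[d [Dd edn]]|none] := pselect (exists d, D d /\ e d = n).
  apply: Ksub (KF d Dd) => z [d' [Dd' ed'n] Fz].
  by rewrite (inj_e d d') ?inE ?edn ?ed'n.
by apply: Ksub K0 => z [d Dd _]; case: none; exists d.
Qed.

Lemma sigma_idealU (T : Type) (K : set (set T)) (M N : set T) :
  sigma_ideal K -> K M -> K N -> K (M `|` N).
Proof.
move=> sK KM KN; have [_ Ksub _] := sK.
apply: (Ksub _ (\bigcup_(b in [set: bool]) if b then M else N)).
  by move=> z [Mz|Nz]; [exists true | exists false].
by apply: sigma_ideal_bigcup => // -[].
Qed.

Lemma dense_image (T U : topologicalType) (p : T -> U) (D : set T) :
  continuous p -> (forall u, exists t, p t = u) -> dense D -> dense (p @` D).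
Proof.
move=> cp sp dD O [u Ou] oO; have [t ptu] := sp u.
have [|d [Od Dd]] := dD (p @^-1` O) _ (open_comp (in1W cp) oO).
  by exists t; rewrite /= ptu.
by exists (p d); split => //; exists d.
Qed.

(** Choosing, for every point [s] of a countable dense set and every [n], one
    element of [D] whose image is [n.+1%:R^-1]-close to [s] gives countably many
    elements, and their images approximate the dense set, hence everything.
    The choice is made in [D], not in its image, because the translations along
    the other factor use the chosen elements themselves. *)
Lemma countable_dense_image (R : realType) (T : Type) (U : topologicalType)
    (p : T -> U) (D : set T) :
  polish_space R U -> dense (p @` D) ->
  exists D' : set T, [/\ countable D', D' `<=` D & dense (p @` D')].
Proof.
move=> [[S cS dS] [M [f [g [fK gK cf cg _]]]]] dD.
(* Distances are measured in the metric model [M] of [U]. *)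
pose near_s (x : U * nat) (d : T) := D d /\ ball (f x.1) x.2.+1%:R^-1%R (f (p d)).
have /choice[h hP] x : exists d, near_s x d.
  case: x => s n; have r0 : (0 < n.+1%:R^-1 :> R)%R by rewrite invr_gt0 ltr0n.
  have nb : nbhs s (f @^-1` ball (f s) n.+1%:R^-1%R).
    by apply: cf; exact: nbhsx_ballx.
  have [||u [/interior_subset Bu [d Dd pdu]]] :=
      dD (f @^-1` ball (f s) n.+1%:R^-1%R)^°.
  - by exists s.
  - exact: open_interior.
  - by exists d; split => //=; rewrite pdu.
exists (\bigcup_n [set h (s, n) | s in S]); split.
- apply: bigcup_countable => // n _.
  exact: card_le_trans (card_image_le _ _) cS.
- by move=> _ [n _ [s _ <-]]; have [] := hP (s, n).
move=> O [u Ou] oO.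
have : nbhs (f u) (g @^-1` O).
  by apply: cg; rewrite fK; exact: open_nbhs_nbhs.
rewrite -nbhs_ballE => -[e /= e0 eO].
(* Half of [e] is spent going from [u] to [s], half from [s] to the image. *)
have [n _ /(_ n (leqnn n)) ne] :=
  near_infty_natSinv_lt (PosNum (divr_gt0 e0 (ltr0n R 2))).
have r0 : (0 < n.+1%:R^-1 :> R)%R by rewrite invr_gt0 ltr0n.
have nb : nbhs u (f @^-1` ball (f u) n.+1%:R^-1%R).
  by apply: cf; exact: nbhsx_ballx.
have [||s [/interior_subset Bs Ss]] := dS (f @^-1` ball (f u) n.+1%:R^-1%R)^°.
- by exists u.
- exact: open_interior.
have [Dh Bh] := hP (s, n).
exists (p (h (s, n))); split; last by exists (h (s, n)) => //; exists n => //; exists s.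
rewrite -[p _]fK; apply: eO.
apply: ball_split; [exact: le_ball (ltW ne) _ Bs|exact: le_ball (ltW ne) _ Bh].
Qed.

Lemma sigma_algebraU (T : Type) (S : set (set T)) (M N : set T) :
  sigma_algebra setT S -> S M -> S N -> S (M `|` N).
Proof.
move=> [S0 _ Sbig] SM SN; rewrite -bigcup2E.
by apply: Sbig => -[|[|n]].
Qed.

Lemma sigma_algebraD (T : Type) (S : set (set T)) (M N : set T) :
  sigma_algebra setT S -> S M -> S N -> S (M `\` N).
Proof.
move=> sS SM SN; have [_ SC _] := sS.
have SC' P : S P -> S (~` P) by move=> /SC; rewrite setTD.
have -> : M `\` N = ~` (~` M `|` N) by rewrite setCU setCK setDE.
by apply: (SC'); exact: sigma_algebraU sS (SC' _ SM) SN.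
Qed.

(** The set [N] need not be measurable, so it is first enlarged to a measurable
    set of the ideal; this is why [E] may be smaller than [M `\` N]. *)
Lemma measurable_core (T : Type) (S K : set (set T)) (M N : set T) :
  sigma_algebra setT S -> sigma_ideal K -> has_base S K ->
  S M -> ~ K M -> K N ->
  exists2 E : set T, (S `\` K) E & E `<=` M `\` N.
Proof.
move=> sS sK hb SM KM KN; have [_ Ksub _] := sK.
have [N' [SN' KN'] NN'] := hb _ KN.
exists (M `\` N'); last by move=> x [Mx N'x]; split => // /NN'.
split; first exact: sigma_algebraD.
move=> KMN'; apply: KM; apply: Ksub (sigma_idealU sK KMN' KN') => x Mx.
by have [N'x|N'x] := pselect (N' x); [right | left].
Qed.

(** Enlarging [I0] and [J0] to measurable null sets makes the cross measurable;
    its section at a point outside the first one is then inside the second. *)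
Lemma fubini_product_cross (X Y : Type) (A : set (set X)) (B : set (set Y))
    (I : set (set X)) (J : set (set Y)) (I0 : set X) (J0 : set Y)
    (K : set (X * Y)) :
  sigma_algebra setT A -> sigma_algebra setT B ->
  sigma_ideal I -> sigma_ideal J -> has_base A I -> has_base B J ->
  I I0 -> J J0 -> K `<=` fst @^-1` I0 `|` snd @^-1` J0 ->
  fubini_product A B I J K.
Proof.
move=> sA sB [_ Isub _] [_ Jsub _] hA hB.
move=> /hA[I1 [AI1 II1] I01] /hB[J1 [BJ1 JJ1] J01] KI.
(* The strips are rectangles with one full side. *)
have fullS (T : Type) (S : set (set T)) : sigma_algebra setT S -> S setT.
  by move=> [S0 SC _]; rewrite -(setD0 setT); exact: SC.
exists (I1 `*` setT `|` setT `*` J1).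
  apply: (@sigma_algebraU _ (prod_sigma_algebra A B)).
  - exact: smallest_sigma_algebra.
  - by apply: sub_sigma_algebra; exists I1 => //; exists setT => //; exact: fullS.
  - by apply: sub_sigma_algebra; exists setT; [exact: fullS | exists J1].
split; first by move=> z /KI[/I01|/J01]; [left | right].
apply: Isub II1 => x Jx; apply: contrapT => I1x; apply: Jx.
by apply: Jsub JJ1 => y; rewrite /xsection /= inE => -[[]|[]].
Qed.

(** The heart of the argument.  The maps [p] and [q] stand for the two
    projections of a product, in either order, so that one proof serves the tall
    and the wide hull.  Only [p @` D'] has to be dense, as the Smital property is
    applied in [U]; in [V] the elements of [D'] act by translations alone, and
    countability of [D'] is what keeps the resulting union in [L]. *)
Lemma compl_sumset_sub_cross (R : realType) (Z : PreTopologicalZmodule.type)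
    (U : topologicalZmodType) (V : zmodType) (p : Z -> U) (q : Z -> V)
    (S K : set (set U)) (L : set (set V)) (C D : set Z) (E : set U)
    (M : set V) :
  polish_space R U -> sigma_ideal L -> translation_invariant L ->
  smital_property S K ->
  continuous p -> (forall u, exists z, p z = u) ->
  {morph p : x y / (x - y)%R} -> {morph q : x y / (x - y)%R} ->
  dense D -> (S `\` K) E -> L M -> p @^-1` E `&` q @^-1` (~` M) `<=` C ->
  exists N' M', [/\ K N', L M' &
    ~` [set (c + d)%R | c in C & d in D] `<=` p @^-1` N' `|` q @^-1` M'].
Proof.
move=> polU sL tL SP cp sp pB qB dD SE LM EMC.
have [D' [cD' D'D dD']] := countable_dense_image polU (dense_image cp sp dD).
exists (~` [set (a + d)%R | a in E & d in p @` D']).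
exists (\bigcup_(d in D') [set (q d + m)%R | m in M]); split.
- exact: SP.
- by apply: sigma_ideal_bigcup => // d _; exact: tL.
move=> z CDz; apply: contrapT => /not_orP[/contrapT[a Ea [_ [d D'd <-]] apd] Mz].
apply: CDz; exists (z - d)%R; last by exists d; [exact: D'D | rewrite subrK].
(* The point [z - d] lies over [a], so only its [q]-coordinate matters. *)
apply: EMC; split; rewrite /preimage /=.
- by rewrite pB -apd addrK.
- rewrite qB => Mzd; apply: Mz; exists d => //; exists (q z - q d)%R => //.
  by rewrite addrC subrK.
Qed.

Theorem theorem24 (R : realType) (X Y : topologicalZmodType)
    (A : set (set X)) (B : set (set Y)) (I : set (set X)) (J : set (set Y)) :
  polish_space R X -> polish_space R Y ->
  sigma_algebra setT A -> sigma_algebra setT B ->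
  sigma_ideal I -> sigma_ideal J ->
  contains_singletons I -> contains_singletons J ->
  has_base A I -> has_base B J ->
  [/\ tall_rectangle_hull A B I J, smital_property A I &
      translation_invariant J] \/
  [/\ wide_rectangle_hull A B I J, smital_property B J &
      translation_invariant I] ->
  smital_property (prod_sigma_algebra A B) (fubini_product A B I J).
Proof.
move=> polX polY sA sB sI sJ _ _ hA hB hyp D dD C [ABC nullC].
have cross (K : set (X * Y)) I0 J0 : I I0 -> J J0 ->
    K `<=` fst @^-1` I0 `|` snd @^-1` J0 -> fubini_product A B I J K.
  exact: fubini_product_cross.
case: hyp => [[hull SP tJ]|[hull SP tI]];
    have [Ct [I0 [J0 [mCt II0 JJ0 lowC upC]]]] := hull _ ABC.
- have nCt : ~ I Ct.
    move=> ICt; apply/nullC/(cross _ _ _ (sigma_idealU sI ICt II0) JJ0).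
    by move=> z /upC[[[]|[]]|[]]; [left; left | left; right | right].
  have [E AE subE] := measurable_core sA sI hA mCt nCt II0.
  have [|||||I1 [J1 [II1 JJ1 sub1]]] :=
      @compl_sumset_sub_cross R (X * Y)%type X Y fst snd A I J C D E J0
        polX sJ tJ SP _ _ _ _ dD AE JJ0.
  + by move=> z; exact: cvg_fst.
  + by move=> x; exists (x, 0%R).
  + by [].
  + by [].
  + by move=> z [/subE ? ?]; apply: lowC.
  + exact: cross II1 JJ1 sub1.
- have nCt : ~ J Ct.
    move=> JCt; apply/nullC/(cross _ _ _ II0 (sigma_idealU sJ JCt JJ0)).
    by move=> z /upC[[[]|[]]|[]]; [right; left | left | right; right].
  have [E BE subE] := measurable_core sB sJ hB mCt nCt JJ0.
  have [|||||J1 [I1 [JJ1 II1 sub1]]] :=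
      @compl_sumset_sub_cross R (X * Y)%type Y X snd fst B J I C D E I0
        polY sI tI SP _ _ _ _ dD BE II0.
  + by move=> z; exact: cvg_snd.
  + by move=> y; exists (0%R, y).
  + by [].
  + by [].
  + by move=> z [/subE ? ?]; apply: lowC.
  + by apply: cross II1 JJ1 _; rewrite setUC.
Qed.
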